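(* For $T>0$, let $\sigma_\infty(T)=\sup_{f\in\mathcal{L}_2(T)}\|f'\|_\infty$. Then $$\sigma_\infty(T)=\begin{cases}2/T+T/2 & (T\le 2),\\ 2 & (T\ge 2).\end{cases}$$
   Context: For $T>0$, $\mathcal{L}_2(T)$ is the set of functions $f:[0,T]\to\mathbb{R}$ that are differentiable on $[0,T]$ (one-sided at the endpoints), with $f'$ absolutely continuous, such that $|f(t)|\le 1$ for all $t\in[0,T]$ and $|f''(t)|\le 1$ for almost every $t\in[0,T]$ (equivalently, $|f|\le1$ and $f'$ is $1$-Lipschitz). $\|\cdot\|_\infty$ is the (essential) supremum norm on $[0,T]$. *)

(* Defs.v *)
From HB Require Import structures.
From mathcomp Require Import all_boot all_order all_algebra.
From mathcomp Require Import all_classical all_reals all_analysis.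

Set Implicit Arguments.
Unset Strict Implicit.
Unset Printing Implicit Defensive.

Import Order.TTheory GRing.Theory Num.Theory.
Import numFieldNormedType.Exports.

Local Open Scope classical_set_scope.
Local Open Scope ring_scope.

(* Functions on [0, T] are represented by total functions R -> R, and every
   notion below only depends on their values on [0, T]. *)

(* The limits are taken along s in A with s <> t, so for A = [0, T] the
   derivative is two-sided at interior points and one-sided at 0 and T. *)
Definition derivable_in (R : realType) (A : set R) (f : R -> R) (t : R) : Prop :=
  cvg ((f s - f t) / (s - t) @[s --> within A t^']).

Definition derive_in (R : realType) (A : set R) (f : R -> R) (t : R) : R :=
  lim ((f s - f t) / (s - t) @[s --> within A t^']).

Definition absolutely_continuous (R : realType) (a b : R) (g : R -> R) : Prop :=
  forall e : R, 0 < e -> exists2 d : R, 0 < d &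
    forall (n : nat) (u v : 'I_n -> R),
      (forall i, a <= u i /\ u i <= v i /\ v i <= b) ->
      trivIset [set: 'I_n] (fun i => `]u i, v i[%classic) ->
      \sum_(i < n) (v i - u i) < d ->
      \sum_(i < n) `|g (v i) - g (u i)| < e.

(* The derivative of an absolutely continuous function exists almost
   everywhere; since lim is total, this existence is recorded next to the
   bound so that |f''| <= 1 never refers to a default value. *)
Definition L2 (R : realType) (T : R) : set (R -> R) :=
  let I := `[0, T]%classic in
  [set f | [/\ forall t, I t -> derivable_in I f t,
               absolutely_continuous 0 T (derive_in I f),
               forall t, I t -> `|f t| <= 1 &
               {ae @lebesgue_measure R, forall t, I t ->
                  derivable_in I (derive_in I f) t /\
                  `|derive_in I (derive_in I f) t| <= 1}]].

Definition normoo (R : realType) (T : R) (g : R -> R) : \bar R :=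
  Lnorm (mrestr (@lebesgue_measure R) (measurable_itv `[0, T]))
    +oo%E (EFin \o g).

Definition sigmaoo (R : realType) (T : R) : \bar R :=
  ereal_sup [set normoo T (derive_in `[0, T] f) | f in L2 T].

(* Main.v *)
(* Upper bound: an absolutely continuous f' with |f''| <= 1 almost everywhere is
   1-Lipschitz, so f'(s) >= f'(t) - |s - t|, and integrating over [a, b]
   containing t gives
     2 >= f(b) - f(a) >= f'(t) (b - a) - (b - a)^2 / 2,
   i.e. |f'(t)| <= 2 / (b - a) + (b - a) / 2. Take [a, b] = [0, T] if T <= 2, and
   an interval of length 2 around t otherwise. The bound is attained at 0 by a
   parabola going from -1 to 1 with f'' = -1, continued by 1 after time 2.
   All passages from local to global estimates use Cousin's lemma on tagged
   partitions rather than integration. *)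
Require Import Defs.
From mathcomp Require Import all_boot all_order all_algebra.
From mathcomp Require Import all_classical all_reals all_analysis.
From mathcomp Require Import measurable_realfun ess_sup_inf.
From mathcomp Require Import ring lra.

Set Implicit Arguments.
Unset Strict Implicit.
Unset Printing Implicit Defensive.

Import Order.TTheory GRing.Theory Num.Theory.
Import numFieldNormedType.Exports.

Local Open Scope classical_set_scope.
Local Open Scope ring_scope.

(** * Derivatives relative to a set, and Cousin's lemma *)

(** The division-free form allows [s = t], restricts to subsets of [A], and makes sense without
    uniqueness of the limit. *)
Definition has_derive_in (R : realType) (A : set R) (f : R -> R) (t l : R) :=
  forall e : R, 0 < e -> exists2 d : R, 0 < d &
    forall s, A s -> `|s - t| < d -> `|f s - f t - l * (s - t)| <= e * `|s - t|.

Section derive_in.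
Context {R : realType}.
Implicit Types (A : set R) (f g : R -> R) (a b t l : R).

Lemma derivable_in_has A f t :
  derivable_in A f t -> has_derive_in A f t (derive_in A f t).
Proof.
rewrite /derivable_in /derive_in => /cvgrPdist_le H e e0.
have /= := H e e0; rewrite near_withinE /dnbhs near_withinE.
move=> /nbhs_ballP[d /= d0 dP]; exists d => // s As std.
have [->|st] := eqVneq s t; first by rewrite !subrr mulr0 subr0 normr0 mulr0.
have st0 : s - t != 0 by rewrite subr_eq0.
have := dP s; rewrite /ball/= distrC => /(_ std st As).
set l := lim _ => h.
have -> : f s - f t - l * (s - t) = - ((l - (f s - f t) / (s - t)) * (s - t)).
  by field.
by rewrite normrN normrM ler_wpM2r.
Qed.

Lemma has_derive_in_cvg A f t l : has_derive_in A f t l ->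
  (f s - f t) / (s - t) @[s --> within A t^'] --> l.
Proof.
move=> H; apply/cvgrPdist_le => e e0; have [d d0 dP] := H e e0.
rewrite near_withinE /dnbhs near_withinE; apply/nbhs_ballP; exists d => //= s.
rewrite /ball/= distrC => std st As.
have st0 : s - t != 0 by rewrite subr_eq0.
have -> : l - (f s - f t) / (s - t) = - (f s - f t - l * (s - t)) / (s - t).
  by field.
by rewrite normrM normrN normfV ler_pdivrMr ?normr_gt0// dP.
Qed.

(** Limits along this filter are unique because it is proper; this identifies [derive_in], defined
    by [lim], with an explicit derivative. *)
Lemma within_dnbhs_itv_proper a b t : a < b -> `[a, b]%classic t ->
  ProperFilter (within `[a, b] t^').
Proof.
move=> ab; rewrite /= in_itv/= => /andP[at_ tb].
apply: Build_ProperFilter => /nbhs_ballP[d /= d0 dP].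
(* At most half the length of the interval: a step [d1] from [t] towards the farther endpoint stays
   in [a, b]. *)
pose d1 := Num.min (d / 2) ((b - a) / 2).
have d1d : d1 <= d / 2 by rewrite ge_min lexx.
have d1b : d1 <= (b - a) / 2 by rewrite ge_min lexx orbT.
have d10 : 0 < d1 by rewrite lt_min; apply/andP; split; lra.
have [tm|tm] := leP t ((a + b) / 2).
  apply: (dP (t + d1)); rewrite /= ?in_itv/=.
  - by rewrite /ball/= opprD addNKr normrN gtr0_norm; lra.
  - by apply/eqP; lra.
  - by apply/andP; split; lra.
apply: (dP (t - d1)); rewrite /= ?in_itv/=.
- by rewrite /ball/= opprB addrC subrK gtr0_norm; lra.
- by apply/eqP; lra.
- by apply/andP; split; lra.
Qed.

Lemma has_derive_in_derivable A f t l :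
  has_derive_in A f t l -> derivable_in A f t.
Proof. by move=> /has_derive_in_cvg h; apply/cvg_ex; exists l. Qed.

Lemma has_derive_inE a b f t l : a < b -> `[a, b]%classic t ->
  has_derive_in `[a, b] f t l -> derive_in `[a, b] f t = l.
Proof.
move=> ab abt /has_derive_in_cvg h.
have P := within_dnbhs_itv_proper ab abt.
exact: (cvg_lim _ h).
Qed.

Lemma sub_has_derive_in A B f t l : B `<=` A ->
  has_derive_in A f t l -> has_derive_in B f t l.
Proof.
move=> BA H e e0; have [d d0 dP] := H e e0.
by exists d => // s /BA; exact: dP.
Qed.

Lemma has_derive_inB A f g t l m : has_derive_in A f t l ->
  has_derive_in A g t m -> has_derive_in A (f \- g) t (l - m).
Proof.
move=> Hf Hg e e0; have e20 : 0 < e / 2 by lra.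
have [d d0 dP] := Hf _ e20; have [c c0 cP] := Hg _ e20.
exists (Num.min d c) => [|s As]; first by rewrite lt_min d0.
rewrite lt_min => /andP[sd sc] /=.
have -> : f s - g s - (f t - g t) - (l - m) * (s - t) =
  (f s - f t - l * (s - t)) - (g s - g t - m * (s - t)) by ring.
rewrite (le_trans (ler_normB _ _))//.
have := dP s As sd; have := cP s As sc; lra.
Qed.

Lemma has_derive_in_quadratic A f t l :
  (forall s, A s -> `|f s - f t - l * (s - t)| <= (s - t) ^+ 2) ->
  has_derive_in A f t l.
Proof.
move=> H e e0; exists e => // s As ste.
rewrite (le_trans (H s As))// -real_normK ?num_real// expr2.
by rewrite ler_wpM2r// ltW.
Qed.

(** Since [t] lies between [x] and [y], the errors e|x - t| and e|y - t| add up to exactly e(y -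
    x). *)
Lemma has_derive_in_straddle A f t l e : 0 < e -> has_derive_in A f t l ->
  exists2 d, 0 < d & forall x y, A x -> A y -> x <= t <= y -> y - x < d ->
    `|f y - f x - l * (y - x)| <= e * (y - x).
Proof.
move=> e0 H; have [d d0 dP] := H e e0; exists d => // x y Ax Ay /andP[xt ty] yx.
have := dP x Ax; rewrite ler0_norm ?subr_le0// => /(_ _)/wrap[]; first lra.
have := dP y Ay; rewrite ger0_norm ?subr_ge0// => /(_ _)/wrap[]; first lra.
rewrite !ler_norml => /andP[? ?] /andP[? ?]; apply/andP; split; lra.
Qed.

(** Cousin's lemma as an induction principle, with no explicit partition: the supremum of the points
    reachable from [a] is itself reachable, and a small interval around it would pass beyond it
    unless it is [b]. *)
Lemma cousin (P : R -> R -> Prop) a b : a <= b ->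
  (forall x y z, a <= x <= y -> y <= z <= b -> P x y -> P y z -> P x z) ->
  (forall t, a <= t <= b -> exists2 d, 0 < d &
     forall x y, a <= x -> y <= b -> x <= t <= y -> y - x < d -> P x y) ->
  P a b.
Proof.
move=> ab Padd Ploc.
pose S := [set x | a <= x <= b /\ P a x].
have Sa : S a.
  split; first by rewrite lexx.
  have [|d d0 dP] := Ploc a; first by rewrite lexx.
  by apply: dP; rewrite ?lexx// subrr.
have ubS : ubound S b by move=> x [/andP[]].
have supS : has_sup S by split; [exists a|exists b].
have aS : a <= sup S by apply: ub_le_sup => //; exists b.
have Sb : sup S <= b by apply: ge_sup => //; exists a.
have [|d d0 dP] := Ploc (sup S); first by rewrite aS.
have d20 : 0 < d / 2 by lra.
have [x [/andP[ax xb] Pax] xS] := sup_adherent d20 supS.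
have xS' : x <= sup S by apply: ub_le_sup; [exists b|split=> //; apply/andP].
(* As [x] is within d/2 below the supremum, y - x < 3d/4 < d. *)
pose y := Num.min b (sup S + d / 4).
have yb : y <= b by rewrite ge_min lexx.
have yS : y <= sup S + d / 4 by rewrite ge_min lexx orbT.
have Sy : sup S <= y by rewrite le_min Sb/=; lra.
have Pay : P a y.
  apply: (Padd a x y) => //; first by rewrite lexx.
    by apply/andP; split; lra.
  by apply: dP => //; [apply/andP|lra].
have : y <= sup S.
  by apply: ub_le_sup; [exists b|split => //; rewrite yb andbT; lra].
rewrite /y ge_min => /orP[bS|]; last lra.
suff <- : y = b by [].
by apply/eqP; rewrite eq_le yb; lra.
Qed.

End derive_in.

(** * Mean value inequalities, everywhere and almost everywhere *)

Section mean_value.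
Context {R : realType}.
Implicit Types (f g : R -> R) (a b t : R).

Lemma has_derive_in_ge0_le f g a b : a <= b ->
  (forall t, a <= t <= b -> has_derive_in `[a, b] f t (g t) /\ 0 <= g t) ->
  f a <= f b.
Proof.
move=> ab H.
suff K e : 0 < e -> f a <= f b + e * (b - a).
  apply/ler_addgt0Pr => e e0.
  (* The added 1 keeps the denominator positive when a = b. *)
  have ba1 : 0 < b - a + 1 by lra.
  rewrite (le_trans (K (e / (b - a + 1)) _)) ?divr_gt0// lerD2l.
  rewrite mulrAC ler_pdivrMr// ler_pM2l//; lra.
move=> e0; apply: (@cousin _ (fun x y => f x <= f y + e * (y - x)) a b) => //.
  by move=> x y z _ _ /=; lra.
move=> t abt; have [Ht g0] := H t abt.
have [d d0 dP] := has_derive_in_straddle e0 Ht; exists d => // x y ax yb xty xyd.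
have [xt ty] := andP xty.
have [xab yab] : `[a, b]%classic x /\ `[a, b]%classic y.
  by split; rewrite /= in_itv/=; apply/andP; split; lra.
have := dP x y xab yab xty xyd; rewrite ler_norml => /andP[h _].
have : 0 <= g t * (y - x) by rewrite mulr_ge0//; lra.
lra.
Qed.

Lemma absolutely_continuousS g a b a' b' : a <= a' -> b' <= b ->
  absolutely_continuous a b g -> absolutely_continuous a' b' g.
Proof.
move=> aa bb H e /H[d d0 dP]; exists d => // n u v uv; apply: dP => i.
by have [? []] := uv i; do !split => //; lra.
Qed.

(** Turns a small measure of [U] into the small total length that absolute continuity asks for. *)
Lemma sum_itv_le_measure n (u v : 'I_n -> R) (U : set R) :
  (forall i, u i <= v i) -> trivIset [set: 'I_n] (fun i => `]u i, v i[%classic) ->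
  (forall i, `]u i, v i[ `<=` U) -> measurable U ->
  ((\sum_(i < n) (v i - u i))%:E <= lebesgue_measure U)%E.
Proof.
move=> uv uvT uvU mU.
have -> : ((\sum_(i < n) (v i - u i))%:E =
    lebesgue_measure (\bigcup_(i in [set: 'I_n]) `]u i, v i[%classic))%E.
  rewrite measure_fin_bigcup//; last by exact: finite_finset.
  have -> : [set: 'I_n] = [set` index_enum 'I_n].
    by apply/seteqP; split => // i _; exact: mem_index_enum.
  rewrite -fsbig_seq ?index_enum_uniq// -sumEFin; apply: eq_bigr => i _.
  apply/esym; apply: (etrans (lebesgue_measure_itv _)).
  rewrite /= lte_fin; case: ltP => // vu.
  have -> : u i = v i by apply/eqP; rewrite eq_le uv.
  by rewrite subrr.
apply: le_measure; rewrite ?inE//; last by move=> x [i _ /uvU].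
by apply: fin_bigcup_measurable => //; exact: finite_finset.
Qed.

(** Serves to concatenate the interval families attached to two adjacent intervals. *)
Lemma trivIset_split m n (F : 'I_m -> set R) (G : 'I_n -> set R) :
  trivIset setT F -> trivIset setT G ->
  (forall i j, F i `&` G j = set0) ->
  trivIset setT (fun i : 'I_(m + n) =>
    match fintype.split i with inl i => F i | inr j => G j end).
Proof.
move=> tF tG FG i j _ _.
case: (split_ordP i) => i' ->; case: (split_ordP j) => j' ->.
- by move=> /tF => ->.
- by rewrite FG => /set0P/eqP.
- by rewrite setIC FG => /set0P/eqP.
- by move=> /tG => ->.
Qed.

(** The exceptional null set is enclosed in an open [U] of measure below the [d] that absolute
    continuity assigns to [e]. Increments over intervals inside [U] then total less than [e], and
    elsewhere the slope is at most M + e. *)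
Lemma absolutely_continuous_ler_norm g g' a b M : a <= b -> 0 <= M ->
  absolutely_continuous a b g ->
  {ae @lebesgue_measure R, forall t, `[a, b]%classic t ->
     has_derive_in `[a, b] g t (g' t) /\ `|g' t| <= M} ->
  `|g b - g a| <= M * (b - a).
Proof.
move=> ab M0 gac [N /= [mN N0 subN]].
suff K e : 0 < e -> `|g b - g a| <= (M + e) * (b - a) + e.
  apply/ler_addgt0Pr => e e0.
  have ba1 : 0 < b - a + 1 by lra.
  rewrite (le_trans (K (e / (b - a + 1)) _)) ?divr_gt0//.
  rewrite le_eqVlt; apply/orP; left; apply/eqP; field; lra.
move=> e0; have [d d0 dP] := gac e e0.
have [|U [oU NU UNd]] := lebesgue_regularity_outer mN _ d0.
  by rewrite [X in (X < _)%E]N0.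
(* Outer regularity bounds the measure of U minus N; adding the null set N changes nothing. *)
have Ud : (lebesgue_measure U < d%:E)%E.
  rewrite -(setDUK NU) measureU//.
  - by rewrite [X in (X + _)%E]N0 add0e.
  - by apply: measurableD => //; exact: open_measurable.
  - by rewrite setDE setIC -setIA setICl setI0.
(* Intervals tagged in N lie in U and are controlled by absolute continuity;
   those tagged outside N are controlled by the derivative. *)
pose P x y := exists n (u v : 'I_n -> R),
  [/\ forall i, x <= u i /\ u i <= v i /\ v i <= y,
      trivIset setT (fun i => `]u i, v i[%classic),
      forall i, `]u i, v i[ `<=` U &
      `|g y - g x| <= (M + e) * (y - x) + \sum_(i < n) `|g (v i) - g (u i)|].
suff [n [u [v [uvab uvT uvU gab]]]] : P a b.
  rewrite (le_trans gab)// lerD2l ltW// dP// -lte_fin.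
  apply: le_lt_trans Ud; apply: sum_itv_le_measure => //.
    by move=> i; have [_ []] := uvab i.
  exact: open_measurable.
apply: cousin => //.
  move=> x y z /andP[ax xy] /andP[yz zb].
  move=> [m [u [v [uv uvT uvU h]]]] [n [u' [v' [uv' uvT' uvU' h']]]].
  exists (m + n)%N,
    (fun i => match fintype.split i with inl j => u j | inr j => u' j end),
    (fun i => match fintype.split i with inl j => v j | inr j => v' j end).
  split.
  - move=> i; case: (fintype.split i) => j.
      by have [? []] := uv j; do !split => //; lra.
    by have [? []] := uv' j; do !split => //; lra.
  - rewrite [F in trivIset _ F](_ : _ = fun i => match fintype.split i with
        inl j => `]u j, v j[%classic | inr j => `]u' j, v' j[%classic end).
      apply: trivIset_split => // i j.
      rewrite -subset0 => s []; rewrite /= !in_itv/= => /andP[? ?] /andP[? ?].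
      by have [_ []] := uv i; have [? _] := uv' j; lra.
    by apply/funext => i; case: (fintype.split i).
  - by move=> i; case: (fintype.split i).
  - rewrite big_split_ord/=.
    under eq_bigr do rewrite (unsplitK (inl _)).
    under [X in _ + (_ + X)]eq_bigr do rewrite (unsplitK (inr _)).
    rewrite (_ : g z - g x = (g y - g x) + (g z - g y)); last by ring.
    rewrite (le_trans (ler_normD _ _))//; lra.
move=> t abt; have [Nt|Nt] := pselect (N t).
  have /nbhs_ballP[r /= r0 rU] : nbhs t U.
    by apply: open_nbhs_nbhs; split => //; exact: NU.
  exists r => // x y ax yb /andP[xt ty] xyr.
  exists 1%N, (fun=> x), (fun=> y); split.
  - by move=> _; lra.
  - by move=> i j _ _ _; rewrite !ord1.
  - move=> _ s; rewrite /= in_itv/= => /andP[xs sy]; apply: rU.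
    by rewrite /ball/= ltr_norml; apply/andP; split; lra.
  - rewrite big_ord1 lerDr mulr_ge0//; lra.
have [gt gM] : has_derive_in `[a, b] g t (g' t) /\ `|g' t| <= M.
  by apply: contrapT => h; apply/Nt/subN => /= /(_ _)/wrap[].
have [r r0 rP] := has_derive_in_straddle e0 gt.
exists r => // x y ax yb xty xyr; exists 0%N, (fun=> 0), (fun=> 0); split.
- by case.
- by case.
- by case.
have [xt ty] := andP xty.
rewrite big_ord0 addr0.
rewrite -[g y - g x](subrK (g' t * (y - x))).
rewrite (le_trans (ler_normD _ _))// addrC mulrDl lerD//.
  rewrite normrM [`|y - x|]ger0_norm ?ler_wpM2r//; lra.
apply: rP => //; rewrite /= in_itv/=; apply/andP; split; lra.
Qed.
End mean_value.

(** * The upper bound on the derivative *)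

Section upper_bound.
Context {R : realType}.
Implicit Types (f g : R -> R) (a b t T : R).

(** Comparison with the antiderivative of a minorant of f' gives the loss ((t - a)^2 + (b - t)^2) /
    2, at most (b - a)^2 / 2, with equality when [t] is an endpoint. *)
Lemma lipschitz_derive_increment f g a b t : a <= t <= b ->
  (forall r, a <= r <= b -> has_derive_in `[a, b] f r (g r)) ->
  (forall r, a <= r <= b -> `|g r - g t| <= `|r - t|) ->
  g t * (b - a) - (b - a) ^+ 2 / 2 <= f b - f a.
Proof.
move=> /andP[at_ tb] fg glip.
have ab : a <= b by lra.
(* q' = g t - |s - t| is a lower bound for f'. *)
pose q s := g t * s - (s - t) * `|s - t| / 2.
have dq r : has_derive_in `[a, b] q r (g t - `|r - t|).
  apply: has_derive_in_quadratic => s _; rewrite /q.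
  rewrite ler_norml.
  (* With u = s - t and v = r - t only a quadratic inequality in u and v remains, by cases on their
     signs. *)
  have [u ->] : exists u, s = t + u by exists (s - t); ring.
  have [v ->] : exists v, r = t + v by exists (r - t); ring.
  rewrite [t + u]addrC [t + v]addrC !addrK.
  have uv2 := sqr_ge0 (u - v); have := sqr_ge0 u; have := sqr_ge0 v.
  have [u0|u0] := leP 0 u; have [v0|v0] := leP 0 v.
  - by rewrite !ger0_norm// => *; apply/andP; split; nra.
  - have uv : u * v <= 0 by rewrite mulr_ge0_le0// ltW.
    by rewrite ger0_norm// ltr0_norm// => *; apply/andP; split; nra.
  - have uv : u * v <= 0 by rewrite mulr_le0_ge0// ltW.
    by rewrite ltr0_norm// ger0_norm// => *; apply/andP; split; nra.
  - by rewrite !ltr0_norm// => *; apply/andP; split; nra.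
have : (f \- q) a <= (f \- q) b.
  apply: (has_derive_in_ge0_le (g := fun r => g r - (g t - `|r - t|))) => //.
  move=> r rab.
  split; first by apply: has_derive_inB => //; exact: fg.
  by have := glip r rab; rewrite ler_norml; lra.
rewrite /q /= (ler0_norm (_ : a - t <= 0)) ?(ger0_norm (_ : 0 <= b - t));
  [nra|lra|lra].
Qed.

Lemma lipschitz_derive_bound f g a b t : a < b -> a <= t <= b ->
  (forall r, a <= r <= b -> has_derive_in `[a, b] f r (g r)) ->
  (forall r, a <= r <= b -> `|g r - g t| <= `|r - t|) ->
  `|f a| <= 1 -> `|f b| <= 1 ->
  `|g t| <= 2 / (b - a) + (b - a) / 2.
Proof.
move=> ab tab fg glip; rewrite !ler_norml => /andP[? ?] /andP[? ?].
have h1 := lipschitz_derive_increment tab fg glip.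
have h2 : (- g t) * (b - a) - (b - a) ^+ 2 / 2 <= (- f b) - (- f a).
  apply: (@lipschitz_derive_increment (\- f) (\- g)) => //= r rab; last first.
    by rewrite -opprD normrN; exact: glip.
  move=> e e0; have [d d0 dP] := fg r rab e e0; exists d => // s As sd.
  have -> : - f s - - f r - - g r * (s - r) = - (f s - f r - g r * (s - r)).
    by ring.
  by rewrite normrN; exact: dP.
have ba0 : 0 < b - a by lra.
have -> : 2 / (b - a) + (b - a) / 2 = (2 + (b - a) ^+ 2 / 2) / (b - a).
  by field; lra.
apply/andP; split; last by rewrite ler_pdivlMr//; lra.
by rewrite lerNl ler_pdivlMr//; lra.
Qed.

Lemma L2_derive_lipschitz T f r s : L2 T f -> 0 <= r <= T -> 0 <= s <= T ->
  `|derive_in `[0, T] f r - derive_in `[0, T] f s| <= `|r - s|.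
Proof.
move=> [_ fac _ fae].
wlog rs : r s / r <= s.
  move=> W rT sT; have [/ltW sr|rs] := ltP s r; last exact: W.
  by rewrite distrC (distrC r); exact: W.
move=> /andP[r0 rT] /andP[s0 sT].
rewrite distrC [leRHS]distrC [leRHS]ger0_norm ?subr_ge0// -[leRHS]mul1r.
apply: (@absolutely_continuous_ler_norm _ _
  (derive_in `[0, T] (derive_in `[0, T] f))) => //.
  exact: absolutely_continuousS fac.
case: fae => N [mN N0 subN]; exists N; split => // t /= nt; apply: subN => /= tT.
apply: nt; rewrite in_itv/= => /andP[rt ts].
have [|dt dt1] := tT; first by rewrite /= in_itv/=; lra.
split => //; apply: sub_has_derive_in (derivable_in_has dt).
by move=> u; rewrite /= !in_itv/=; lra.
Qed.

(** The window [a, b] is left free: 2/h + h/2 decreases up to h = 2, its minimum, so the best length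
    is 2, or [T] if that is shorter. *)
Lemma L2_derive_bound T f t a b : L2 T f -> 0 <= a -> a < b -> b <= T ->
  a <= t <= b -> `|derive_in `[0, T] f t| <= 2 / (b - a) + (b - a) / 2.
Proof.
move=> fL a0 ab bT tab; have [fd _ f1 _] := fL.
have sub : `[a, b] `<=` `[0, T] by move=> u; rewrite /= !in_itv/=; lra.
have [a_ab b_ab] : `[a, b]%classic a /\ `[a, b]%classic b.
  by rewrite /= !in_itv/= !lexx/= ltW.
apply: (@lipschitz_derive_bound f) => //.
- move=> r rab; apply: (sub_has_derive_in sub).
  by apply/derivable_in_has/fd/sub; rewrite /= in_itv.
- by move=> r rab; apply: (L2_derive_lipschitz fL); lra.
- exact/f1/sub.
- exact/f1/sub.
Qed.

(** * Pointwise bounds and the essential supremum *)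

Lemma mrestr_itv_ae T (P : R -> Prop) : (forall t, 0 <= t <= T -> P t) ->
  {ae mrestr (@lebesgue_measure R) (measurable_itv `[0, T]), forall t, P t}.
Proof.
move=> PT; exists (~` `[0, T]%classic); split.
- exact: measurableC.
- by rewrite /mrestr setICl measure0.
- by move=> t /= nPt; rewrite in_itv/= => /PT.
Qed.

(** The norm with exponent +oo unfolds to [ess_sup] only when the total measure is positive. *)
Lemma mrestr_itv_gt0 T : 0 < T ->
  (0 < mrestr (@lebesgue_measure R) (measurable_itv `[0%R, T]) [set: R])%E.
Proof.
move=> T0; rewrite /mrestr setTI lebesgue_measure_itv/= lte_fin T0.
by rewrite oppr0 addr0 lte_fin.
Qed.

Lemma normoo_le T (g : R -> R) M : 0 < T ->
  (forall t, 0 <= t <= T -> `|g t| <= M) -> (normoo T g <= M%:E)%E.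
Proof.
move=> T0 gM; rewrite /normoo unlock/= mrestr_itv_gt0//.
by apply/ess_supP/mrestr_itv_ae => t /gM; rewrite /= lee_fin.
Qed.

(** The essential supremum ignores the value at 0, so the bound is approached on ]0, d[, whose
    positive measure prevents it from lying in a null set. *)
Lemma normoo_ge T (g : R -> R) M : 0 < T ->
  (forall t, 0 < t < T -> M - t <= `|g t|) -> (M%:E <= normoo T g)%E.
Proof.
move=> T0 gM; rewrite /normoo unlock/= mrestr_itv_gt0//.
set mu := mrestr _ _; set E := ess_sup _ _.
have [N [mN N0 subN]] : {ae mu, forall x, (`|g x|%:E <= E)%E}.
  by exact: ess_sup_ge.
apply/lee_addgt0Pr => e e0.
(* Below [e] the loss [t] in the hypothesis is at most [e]; below [T] the interval stays in the
   domain. *)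
pose d := Num.min e T.
have d0 : 0 < d by rewrite lt_min e0.
have [s /andP[s0 sd] Ns] : exists2 s, 0 < s < d & ~ N s.
  apply: contrapT => h.
  have dN : `]0, d[ `<=` N `&` `[0, T].
    move=> s /=; rewrite !in_itv/= => sd; split.
      by apply: contrapT => Ns; apply: h; exists s.
    have dT : d <= T by rewrite ge_min lexx orbT.
    lra.
  have : (lebesgue_measure `]0%R, d[ <= mu N)%E.
    by apply: le_measure => //; rewrite inE//; exact: measurableI.
  by rewrite N0 lebesgue_measure_itv/= lte_fin d0 oppr0 addr0 lee_fin; lra.
have gsE : (`|g s|%:E <= E)%E by apply: contrapT => h; exact/Ns/subN.
have de : d <= e by rewrite ge_min lexx.
have dT : d <= T by rewrite ge_min lexx orbT.
rewrite -leeBlDr//; apply: le_trans gsE; rewrite lee_fin.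
apply: le_trans (gM s _); lra.
Qed.

End upper_bound.

(* [- Num.min s 2] is the derivative of the last two terms: the parabola with
   second derivative [- 1] is continued affinely after [s = 2]. *)
Definition extremal (R : realType) (c s : R) : R :=
  - 1 + c * s - s ^+ 2 / 2 + Num.max (s - 2) 0 ^+ 2 / 2.

(** * Sharpness: the extremal function *)

Section extremal.
Context {R : realType}.
Implicit Types (A : set R) (T c r s t : R).

Lemma has_derive_in_extremal A c t :
  has_derive_in A (extremal c) t (c - Num.min t 2).
Proof.
apply: has_derive_in_quadratic => s _; rewrite /extremal ler_norml.
have := sqr_ge0 (s - t).
by case: (leP t 2) => t2; case: (leP (s - 2) 0) => s2;
  case: (leP (t - 2) 0) => t2' ?; apply/andP; split; nra.
Qed.

Lemma derive_in_extremal T c t : 0 < T -> 0 <= t <= T ->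
  derive_in `[0, T] (extremal c) t = c - Num.min t 2.
Proof.
by move=> T0 tT; apply: has_derive_inE => //; exact: has_derive_in_extremal.
Qed.

Lemma min_lipschitz c s t :
  `|(c - Num.min s 2) - (c - Num.min t 2)| <= `|s - t|.
Proof.
rewrite ler_norml; have := ler_norm (s - t); have := ler_normr (s - t) (s - t).
by case: (leP s 2) => ?; case: (leP t 2) => ?; case: (ger0P (s - t)) => ?;
  lra.
Qed.

Lemma absolutely_continuous_extremal T c : 0 < T ->
  absolutely_continuous 0 T (derive_in `[0, T] (extremal c)).
Proof.
move=> T0 e e0; exists e => // n u v uv _; apply: le_lt_trans.
apply: ler_sum => i _; have [u0 [uvi vT]] := uv i.
rewrite !derive_in_extremal//; [|lra|lra].
by rewrite (le_trans (min_lipschitz _ _ _))// ger0_norm// subr_ge0.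
Qed.

Lemma derive_in2_extremal T c t : 0 < T -> 0 <= t <= T -> t != 2 ->
  derivable_in `[0, T] (derive_in `[0, T] (extremal c)) t /\
  `|derive_in `[0, T] (derive_in `[0, T] (extremal c)) t| <= 1.
Proof.
move=> T0 tT t2.
suff H : has_derive_in `[0, T] (derive_in `[0, T] (extremal c)) t
    (if t < 2 then - 1 else 0).
  split; first exact: has_derive_in_derivable H.
  rewrite (has_derive_inE _ _ H)//.
  by case: ifP => _; rewrite ?normrN ?normr1 ?normr0.
(* This radius keeps [s] on the same side of the kink at 2 as [t]; there the first derivative is
   affine and the remainder vanishes. *)
move=> e e0; exists `|t - 2|; first by rewrite normr_gt0 subr_eq0.
move=> s; rewrite /= in_itv/= => sT; rewrite !derive_in_extremal// => st2.
rewrite [X in `|X|](_ : _ = 0) ?normr0 ?mulr_ge0 ?(ltW e0)//.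
move: st2 t2; case: (ltgtP t 2) => // t2 + _.
  rewrite (ltr0_norm (_ : t - 2 < 0)) ?subr_lt0// ltr_norml => /andP[_ s2].
  by rewrite (min_idPl _); [ring|lra].
rewrite (gtr0_norm (_ : 0 < t - 2)) ?subr_gt0// ltr_norml => /andP[s2 _].
by rewrite (min_idPr _); [ring|lra].
Qed.

Lemma L2_extremal T c : 0 < T ->
  (forall t, 0 <= t <= T -> `|extremal c t| <= 1) -> L2 T (extremal c).
Proof.
move=> T0 f1; split.
- by move=> t _; apply: has_derive_in_derivable (has_derive_in_extremal _ _ _).
- exact: absolutely_continuous_extremal.
- by move=> t; rewrite /= in_itv => /f1.
- exists [set 2]; split; [exact: measurable_set1|exact: lebesgue_measure_set1|].
  move=> t /= nt; apply: contrapT => /eqP t2; apply: nt.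
  by rewrite in_itv => tT; exact: derive_in2_extremal.
Qed.

Lemma extremal_bounded_le2 T t : 0 < T <= 2 -> 0 <= t <= T ->
  `|extremal (2 / T + T / 2) t| <= 1.
Proof.
move=> /andP[T0 T2] /andP[t0 tT]; rewrite /extremal.
have -> : Num.max (t - 2) 0 = 0 by apply/max_idPr; lra.
have pT : 2 / T * T = 2 by rewrite mulfVK// gt_eqF.
have p1 : 1 <= 2 / T by rewrite ler_pdivlMr// mul1r.
move: (2 / T) pT p1 => p pT p1.
(* With pT = 2 these two products are 1 - f(t) and f(t) + 1; T <= 2 enters through p >= 1 >= t/2. *)
have h : 0 <= (T - t) * (p - t / 2) by apply: mulr_ge0; lra.
have h' : 0 <= t * (p + (T - t) / 2) by apply: mulr_ge0; lra.
by rewrite ler_norml; apply/andP; split; lra.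
Qed.

Lemma extremal_bounded2 t : 0 <= t -> `|extremal 2 t| <= 1.
Proof.
(* Up to time 2 the function is 1 - (2 - t)^2 / 2, and afterwards it is constantly 1. *)
move=> t0; rewrite /extremal ler_norml; have := sqr_ge0 (2 - t).
case: (leP (t - 2) 0) => t2 ?; last by apply/andP; split; lra.
have h : 0 <= t * (2 - t) by apply: mulr_ge0; lra.
by apply/andP; split; lra.
Qed.

Lemma normoo_extremal_ge T c : 0 < T ->
  (c%:E <= normoo T (derive_in `[0%R, T] (extremal c)))%E.
Proof.
move=> T0; apply: normoo_ge => // t /andP[t0 tT].
rewrite derive_in_extremal//; last by apply/andP; split; lra.
apply: le_trans (ler_norm _); rewrite lerD2l lerN2 ge_min lexx//.
Qed.

(** Both regimes share this criterion: [c] is at once the upper bound and the initial slope of the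
    extremal function. *)
Lemma sigmaoo_eq T c : 0 < T ->
  (forall t, 0 <= t <= T -> `|extremal c t| <= 1) ->
  (forall f t, L2 T f -> 0 <= t <= T -> `|derive_in `[0, T] f t| <= c) ->
  sigmaoo T = c%:E.
Proof.
move=> T0 f1 ub; apply/eqP; rewrite eq_le; apply/andP; split.
  apply: ge_ereal_sup => _ [f fL <-].
  by apply: normoo_le => // t; exact: ub.
apply: le_trans (normoo_extremal_ge c T0) _.
by apply: ereal_sup_ubound; exists (extremal c) => //; exact: L2_extremal.
Qed.

End extremal.

Theorem proposition11 (R : realType) (T : R) (hT : 0 < T) :
  (T <= 2 -> sigmaoo T = (2 / T + T / 2)%:E) /\
  (2 <= T -> sigmaoo T = 2%:E).
Proof.
split=> T2; apply: sigmaoo_eq => //.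
- by move=> t; apply: extremal_bounded_le2; rewrite hT.
- move=> f t fL tT.
  by have := L2_derive_bound fL (lexx 0) hT (lexx T) tT; rewrite subr0.
- by move=> t /andP[t0 _]; exact: extremal_bounded2.
- move=> f t fL /andP[t0 tT].
  have [a [a0 [aT [at_ ta]]]] :
      exists a, 0 <= a /\ a + 2 <= T /\ a <= t /\ t <= a + 2.
    (* The window of length 2 starts at [t] if it fits, and otherwise ends at [T]. *)
    have [h|h] := leP t (T - 2).
      by exists t; (split; [|split; [|split]]); lra.
    by exists (T - 2); (split; [|split; [|split]]); lra.
  have := @L2_derive_bound _ T f t a (a + 2) fL a0 _ aT.
  rewrite (_ : a + 2 - a = 2); last by ring.
  rewrite divff// -[1 + 1]/2; apply; first lra.
  exact/andP.
Qed.
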